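(* Let $\mathfrak{G}^{\mathfrak{s}}$ be an abelian group with a distinguished element $\mathfrak{s}$ satisfying $\mathfrak{s}^2=1$. Let $\Phi_1$ and $\Phi_2$ be $\mathfrak{G}^{\mathfrak{s}}$-gain graphs with the same underlying finite simple graph $\Gamma$. If $(\Phi_1,\omega)$ and $(\Phi_2,\kappa)$ are oriented $\mathfrak{G}^{\mathfrak{s}}$-gain graphs with $\Phi_1\sim\Phi_2$ (switching equivalent), then the gain graphs $\Phi(\omega_\Lambda)$ and $\Phi(\kappa_\Lambda)$ on the line graph of $\Gamma$ are switching equivalent: $\Phi(\omega_\Lambda)\sim\Phi(\kappa_\Lambda)$.
   Context: All graphs are finite and simple. $\mathfrak{G}^{\mathfrak{s}}$ denotes a group with a distinguished central element $\mathfrak{s}$ with $\mathfrak{s}^2=1$ (the identity is allowed). For an edge $e=v_iv_j$ of a graph $\Gamma=(V,E)$, write $e_{ij}$ both for the edge and for the oriented edge from $v_i$ to $v_j$. A $\mathfrak{G}^{\mathfrak{s}}$-gain graph $\Phi=(\Gamma,\phi)$ is a graph $\Gamma$ with a function $\phi$ from the oriented edges (two opposite orientations for each edge) to $\mathfrak{G}^{\mathfrak{s}}$ with $\phi(e_{ij})=\phi(e_{ji})^{-1}$. For $\zeta:V\to\mathfrak{G}^{\mathfrak{s}}$, the switched gain graph is $\Phi^\zeta=(\Gamma,\phi^\zeta)$ with $\phi^\zeta(e_{ij})=\zeta(v_i)^{-1}\phi(e_{ij})\zeta(v_j)$. Gain graphs $\Phi_1,\Phi_2$ on the same underlying graph are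 switching equivalent, $\Phi_1\sim\Phi_2$, if $\Phi_2=\Phi_1^\zeta$ for some $\zeta$. A $\mathfrak{G}^{\mathfrak{s}}$-incidence phase function on $\Gamma$ is a function $\omega:V\times E\to\mathfrak{G}^{\mathfrak{s}}\cup\{0\}$ with $\omega(v,e)\neq0$ if $v$ is incident to $e$ and $\omega(v,e)=0$ otherwise. The gain graph $\Phi(\omega)$ associated to $\omega$ has gains $$\phi(e_{ij})=\omega(v_i,e_{ij})\cdot\mathfrak{s}\cdot\omega(v_j,e_{ij})^{-1}.$$ An orientation of $\Phi$ is an incidence phase function $\omega$ with $\Phi(\omega)=\Phi$, and an oriented $\mathfrak{G}^{\mathfrak{s}}$-gain graph is a pair $(\Phi,\omega)$ with $\omega$ an orientation of $\Phi$. Let $\Lambda_\Gamma$ be the usual line graph of $\Gamma$ (vertices are the edges of $\Gamma$; two distinct edges are adjacent iff they share an endpoint). Given $\omega$ on $\Gamma$, define an incidence phase function $\omega_\Lambda$ on $\Lambda_\Gamma$ as follows: if $e,f$ are distinct edges of $\Gamma$ sharing the (unique) vertex $v$, then for the edge $ef$ of $\Lambda_\Gamma$ set $\omega_\Lambda(e,ef)=\omega(v,e)^{-1}$ and $\omega_\Lambda(f,ef)=\omega(v,f)^{-1}$; $\omega_\Lambda$ is $0$ on non-incident pairs. $\Phi(\omega_\Lambda)$ is the gain graph on $\Lambda_\Gamma$ whose gains are computed from $\omega_\Lambda$ by the displayed formula with the same $\mathfrak{s}$; $\kappa_\Lambda$ and $\Phi(\kappa_\Lambda)$ are defined likewise from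 $\kappa$. *)

(* Defs.v *)
From HB Require Import structures.
From mathcomp Require Import all_boot.

Set Implicit Arguments.
Unset Strict Implicit.
Unset Printing Implicit Defensive.

Local Open Scope group_scope.

Record sgraph := SGraph {
  vert :> finType;
  adj : rel vert;
  adj_sym : symmetric adj;
  adj_irr : irreflexive adj }.
Arguments adj {s} : rename.

(* An unoriented edge is the set of its two endpoints. *)
Definition is_edge (Gamma : sgraph) (A : {set Gamma}) : bool :=
  [exists u, exists v, adj u v && (A == [set u; v])].

Definition edge (Gamma : sgraph) := {A : {set Gamma} | is_edge A}.

Definition incident (Gamma : sgraph) (v : Gamma) (e : edge Gamma) : bool :=
  v \in val e.

(* The oriented edge (u, v) goes from u to v. *)
Definition dart (Gamma : sgraph) := {p : Gamma * Gamma | adj p.1 p.2}.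

Section Darts.
Variable Gamma : sgraph.
Implicit Type d : dart Gamma.

Definition src d : Gamma := (val d).1.
Definition tgt d : Gamma := (val d).2.

Fact rev_subproof d : adj (tgt d, src d).1 (tgt d, src d).2.
Proof. by rewrite /= adj_sym; exact: (valP d). Qed.

Definition rev d : dart Gamma :=
  exist (fun p : Gamma * Gamma => adj p.1 p.2) _ (rev_subproof d).

Fact edge_of_subproof d : is_edge [set src d; tgt d].
Proof.
apply/existsP; exists (src d); apply/existsP; exists (tgt d).
by rewrite eqxx andbT; exact: (valP d).
Qed.

Definition edge_of d : edge Gamma :=
  exist (fun A : {set Gamma} => is_edge A) _ (edge_of_subproof d).

Lemma incident_src d : incident (src d) (edge_of d).
Proof. exact: set21. Qed.

Lemma incident_tgt d : incident (tgt d) (edge_of d).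
Proof. exact: set22. Qed.

Lemma edge_of_rev d : edge_of (rev d) = edge_of d.
Proof. by apply: val_inj; rewrite /= setUC. Qed.

End Darts.

Record central_involution (G : groupType) := CentralInvolution {
  cinv : G;
  cinv_central : forall x : G, commute cinv x;
  cinv_sq : cinv * cinv = 1 }.

Record gain_graph (G : groupType) (Gamma : sgraph) := GainGraph {
  gain :> dart Gamma -> G;
  gain_rev : forall d, gain d = (gain (rev d))^-1 }.

(* Gain graphs on the same graph are equal when all their gains agree. *)
Definition gain_eq (G : groupType) (Gamma : sgraph)
  (Phi Psi : gain_graph G Gamma) : Prop := forall d, Phi d = Psi d.

Section Switching.
Variables (G : groupType) (Gamma : sgraph).

Definition switch_gain (Phi : gain_graph G Gamma) (zeta : Gamma -> G)
  (d : dart Gamma) : G := (zeta (src d))^-1 * Phi d * zeta (tgt d).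

Fact switch_subproof Phi zeta d :
  switch_gain Phi zeta d = (switch_gain Phi zeta (rev d))^-1.
Proof. by rewrite /switch_gain gain_rev !invgM invgK mulgA. Qed.

Definition switch Phi zeta : gain_graph G Gamma :=
  GainGraph (switch_subproof Phi zeta).

Definition switching_equivalent (Phi1 Phi2 : gain_graph G Gamma) : Prop :=
  exists zeta : Gamma -> G, gain_eq Phi2 (switch Phi1 zeta).

End Switching.

(* G with an adjoined zero is encoded as option G, the zero being None. *)
Record incidence_phase (G : groupType) (Gamma : sgraph) := IncidencePhase {
  phase :> Gamma -> edge Gamma -> option G;
  phase_supp : forall v e, phase v e <> None <-> incident v e }.

Section AssociatedGain.
Variables (G : groupType) (s : central_involution G) (Gamma : sgraph).

(* The default value 1 is never used on incident pairs. *)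
Definition phase_val (w : incidence_phase G Gamma) v e : G := odflt 1 (w v e).

Lemma phase_valK (w : incidence_phase G Gamma) v e :
  incident v e -> w v e = Some (phase_val w v e).
Proof. by rewrite /phase_val => /(phase_supp w); case: (w v e). Qed.

Definition assoc_gain_fun (w : incidence_phase G Gamma) (d : dart Gamma) : G :=
  phase_val w (src d) (edge_of d) * cinv s
    * (phase_val w (tgt d) (edge_of d))^-1.

Fact assoc_gain_subproof w d :
  assoc_gain_fun w d = (assoc_gain_fun w (rev d))^-1.
Proof.
have sV : (cinv s)^-1 = cinv s by rewrite -[LHS]mulg1 -(cinv_sq s) mulKg.
by rewrite /assoc_gain_fun edge_of_rev !invgM invgK sV mulgA.
Qed.

Definition assoc_gain w : gain_graph G Gamma :=
  GainGraph (assoc_gain_subproof w).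

Definition is_orientation (w : incidence_phase G Gamma)
  (Phi : gain_graph G Gamma) : Prop := gain_eq (assoc_gain w) Phi.

End AssociatedGain.

Section LineGraph.
Variable Gamma : sgraph.

Definition line_adj : rel (edge Gamma) := fun e f =>
  (e != f) && [exists v, incident v e && incident v f].

Fact line_adj_sym : symmetric line_adj.
Proof.
move=> e f; rewrite /line_adj eq_sym; congr (_ && _).
by apply: eq_existsb => v; rewrite andbC.
Qed.

Fact line_adj_irr : irreflexive line_adj.
Proof. by move=> e; rewrite /line_adj eqxx. Qed.

Definition line_graph : sgraph := SGraph line_adj_sym line_adj_irr.

(* The vertex of Gamma shared by the two ends of an edge of the line graph;
   by common_vertexE it is always Some v, with v unique. *)
Definition common_vertex (E : edge line_graph) : option Gamma :=
  [pick v | [forall e : edge Gamma, incident (e : line_graph) E ==> incident v e]].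

Lemma edge_two_vertices (e : edge Gamma) (u v : Gamma) :
  u != v -> incident u e -> incident v e -> val e = [set u; v].
Proof.
rewrite /incident; case: e => A /= /existsP[x /existsP[y /andP[xy /eqP->]]].
have nxy : x != y by apply: contraTneq xy => ->; rewrite adj_irr.
move=> uv Hu Hv; apply/esym/eqP; rewrite eqEcard subUset !sub1set Hu Hv /=.
by rewrite !cards2 uv nxy.
Qed.

Lemma common_vertexE (E : edge line_graph) (e f : edge Gamma) (v : Gamma) :
  e != f -> incident (e : line_graph) E -> incident (f : line_graph) E ->
  incident v e -> incident v f -> common_vertex E = Some v.
Proof.
move=> ef; rewrite /incident.
case: E => A HA /= eA fA ve vf; rewrite /common_vertex.
have AE : A = [set e; f].
  case/existsP: (HA) eA fA => x /existsP[y /andP[xy /eqP->]].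
  rewrite !inE; move: ef => /[swap]/orP[]/eqP-> /[swap]/orP[]/eqP->;
    by rewrite ?eqxx // setUC.
case: pickP => [u /forallP Hu|/(_ v)/forallP[] g]; last first.
  by rewrite /incident /= AE !inE; apply/implyP => /orP[]/eqP->.
congr Some; apply/eqP; apply/negPn/negP => uv.
have ue : incident u e by apply: (implyP (Hu e)); rewrite /incident /= AE set21.
have uf : incident u f by apply: (implyP (Hu f)); rewrite /incident /= AE set22.
case/eqP: ef; apply: val_inj.
by rewrite (edge_two_vertices uv ue ve) (edge_two_vertices uv uf vf).
Qed.

Lemma common_vertex_ex (E : edge line_graph) :
  exists2 v, common_vertex E = Some v &
    forall e : edge Gamma, incident (e : line_graph) E -> incident v e.
Proof.
case/existsP: (valP E) => e /existsP[f /andP[/andP[ef /existsP[v /andP[ve vf]]]]].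
move=> /eqP EE; exists v.
  by apply: (common_vertexE ef _ _ ve vf); rewrite /incident EE ?set21 ?set22.
by move=> g; rewrite /incident EE !inE => /orP[]/eqP->.
Qed.

Variables (G : groupType) (w : incidence_phase G Gamma).

Definition line_phase_fun (e : line_graph) (E : edge line_graph) : option G :=
  if incident e E then
    obind (fun v => omap (fun g : G => g^-1) (w v e)) (common_vertex E)
  else None.

Fact line_phase_subproof (e : line_graph) (E : edge line_graph) :
  line_phase_fun e E <> None <-> incident e E.
Proof.
rewrite /line_phase_fun; case: ifP => // eE; split=> // _.
have [v -> /(_ e eE) ve] /= := common_vertex_ex E.
by rewrite (phase_valK w ve).
Qed.

Definition line_phase : incidence_phase G line_graph :=
  IncidencePhase line_phase_subproof.

Lemma line_phaseE (E : edge line_graph) (e f : edge Gamma) (v : Gamma) :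
  e != f -> incident (e : line_graph) E -> incident (f : line_graph) E ->
  incident v e -> incident v f ->
  line_phase e E = Some (phase_val w v e)^-1.
Proof.
move=> ef eE fE ve vf; rewrite /= /line_phase_fun eE.
by rewrite (common_vertexE ef eE fE ve vf) /= (phase_valK w ve).
Qed.

End LineGraph.

(* Main.v *)
Require Import Defs.
From mathcomp Require Import all_boot.

(** Orientations of switching equivalent gain graphs are related edge by edge.
    Write omega and kappa for the two incidence phase functions and zeta for
    the switching function.  Separating the two ends of an edge e = uv in
      kappa(u,e) s kappa(v,e)^-1
        = zeta(u)^-1 omega(u,e) s omega(v,e)^-1 zeta(v)
    and cancelling s shows that omega(v,e)^-1 zeta(v) kappa(v,e) takes the same
    value at both ends of e.  With eta(e) for this value,
      kappa(v,e) = zeta(v)^-1 omega(v,e) eta(e)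
    for every incident pair ([phase_factorization]).

    Passing to the line graph exchanges the roles of zeta and eta.  If e and f
    share the vertex v, then the gain of the line graph edge from e to f is
      kappa(v,e)^-1 s kappa(v,f)
        = eta(e)^-1 omega(v,e)^-1 zeta(v) s zeta(v)^-1 omega(v,f) eta(f),
    and the two factors zeta(v) cancel across s because s is central.
    What remains says that eta switches one line graph gain into the other
    ([line_gain_switch]). *)

Set Implicit Arguments.
Unset Strict Implicit.
Unset Printing Implicit Defensive.

Local Open Scope group_scope.

Lemma edge_dart (Gamma : sgraph) (e : edge Gamma) (u v : Gamma) :
  u != v -> incident u e -> incident v e ->
  exists d : dart Gamma, [/\ src d = u, tgt d = v & edge_of d = e].
Proof.
move=> uv ue ve; have eE := edge_two_vertices uv ue ve.
have uv_adj : adj u v.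
  have /existsP[x /existsP[y /andP[xy /eqP exy]]] := valP e.
  move: ue ve uv; rewrite /incident exy !inE.
  by move=> /orP[]/eqP-> /orP[]/eqP->; rewrite ?eqxx // adj_sym.
exists (exist (fun p : Gamma * Gamma => adj p.1 p.2) (u, v) uv_adj).
by split=> //; apply: val_inj; rewrite eE.
Qed.

Section SwitchedOrientations.
Variables (G : groupType) (s : central_involution G) (Gamma : sgraph).
Variables (omega kappa : incidence_phase G Gamma) (zeta : Gamma -> G).

(** The unique solution x of kappa(v,e) = zeta(v)^-1 omega(v,e) x. *)
Definition end_discrepancy (v : Gamma) (e : edge Gamma) : G :=
  (phase_val omega v e)^-1 * zeta v * phase_val kappa v e.

(** The gain equation on the dart from u to v separates into a part that only
    involves u and a part that only involves v, up to a factor s on each side;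
    these factors cancel because s is central. *)
Lemma end_discrepancy_const (e : edge Gamma) (u v : Gamma) :
  gain_eq (assoc_gain s kappa) (switch (assoc_gain s omega) zeta) ->
  incident u e -> incident v e -> end_discrepancy u e = end_discrepancy v e.
Proof.
move=> kappaE ue ve; have [-> // | uv] := eqVneq u v.
have [d [du dv de]] := edge_dart uv ue ve.
have := kappaE d; rewrite /= /switch_gain /= /assoc_gain_fun du dv de.
rewrite /end_discrepancy => gainE.
(* Multiplying by s kappa(v,e)^-1 makes the gain of kappa appear on the left. *)
apply: (mulIg (cinv s)).
apply: (mulIg (phase_val kappa v e)^-1); rewrite -!mulgA.
rewrite [phase_val kappa u e * _]mulgA gainE -!mulgA mulVKg mulKg.
rewrite [cinv s * (phase_val kappa v e)^-1]cinv_central mulVKg.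
by rewrite [RHS]mulgA -cinv_central.
Qed.

(** Gains determine an orientation only up to one right factor per edge;
    eta is this freedom, and it becomes the switching function on the line
    graph, whose vertices are the edges. *)
Lemma phase_factorization :
  gain_eq (assoc_gain s kappa) (switch (assoc_gain s omega) zeta) ->
  exists eta : edge Gamma -> G, forall v e, incident v e ->
    phase_val kappa v e = (zeta v)^-1 * phase_val omega v e * eta e.
Proof.
move=> kappaE.
(* Either end of e may be picked; 1 stands for an edge without ends. *)
exists (fun e => if [pick u | incident u e] is Some u
                 then end_discrepancy u e else 1) => v e ve.
case: pickP => [u ue | /(_ v)]; last by rewrite ve.
rewrite (end_discrepancy_const kappaE ue ve) /end_discrepancy.
by rewrite -!mulgA mulVKg mulKg.
Qed.

(** Both ends of an edge of the line graph read their phases at the same vertex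
    of Gamma, so the factors zeta of the two phases meet and cancel, while the
    factors eta belong to distinct ends and survive. *)
Lemma line_gain_switch (eta : edge Gamma -> G) :
  (forall v e, incident v e ->
     phase_val kappa v e = (zeta v)^-1 * phase_val omega v e * eta e) ->
  gain_eq (assoc_gain s (line_phase kappa))
          (switch (assoc_gain s (line_phase omega))
             (eta : line_graph Gamma -> G)).
Proof.
move=> kappaE d; rewrite /= /switch_gain /= /assoc_gain_fun.
have := valP d => /= /andP[ef /existsP[v /andP[ve vf]]].
have fe : tgt d != src d by rewrite eq_sym.
have valE (w : incidence_phase G Gamma) :
    phase_val (line_phase w) (src d) (edge_of d)
      = (phase_val w v (src d))^-1 /\
    phase_val (line_phase w) (tgt d) (edge_of d)
      = (phase_val w v (tgt d))^-1.
  by split; rewrite {1}/phase_val;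
    [rewrite (line_phaseE w ef (incident_src d) (incident_tgt d) ve vf)
    |rewrite (line_phaseE w fe (incident_tgt d) (incident_src d) vf ve)].
rewrite !(valE kappa).1 !(valE kappa).2 !(valE omega).1 !(valE omega).2.
rewrite (kappaE v _ ve) (kappaE v _ vf) !invgM !invgK -!mulgA.
by rewrite [cinv s * ((zeta v)^-1 * _)]mulgA cinv_central -!mulgA mulVKg.
Qed.

End SwitchedOrientations.

Theorem theorem4p2 (G : groupType) (G_abelian : forall x y : G, commute x y)
  (s : central_involution G) (Gamma : sgraph)
  (Phi1 Phi2 : gain_graph G Gamma) (omega kappa : incidence_phase G Gamma) :
  is_orientation s omega Phi1 -> is_orientation s kappa Phi2 ->
  switching_equivalent Phi1 Phi2 ->
  switching_equivalent (assoc_gain s (line_phase omega))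
                       (assoc_gain s (line_phase kappa)).
Proof.
move=> omegaP kappaP [zeta Phi2E].
have kappaE : gain_eq (assoc_gain s kappa) (switch (assoc_gain s omega) zeta).
  by move=> d; rewrite kappaP Phi2E /= /switch_gain omegaP.
have [eta etaP] := phase_factorization kappaE.
by exists eta; apply: line_gain_switch etaP.
Qed.
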